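(* Let $m\ge6$ be even, $h=\frac m2$, $f_7(x)=x+x^{2^{h+1}-1}+x^{2^m-2^{h+1}+2}\in\mathbb{F}_{2^m}[x]$, and let $s^\infty$ be the sequence $s_t=\operatorname{Tr}(f_7(\alpha^t+1))$, $t\ge0$. Then the minimal polynomial of $s^\infty$ (generator polynomial of $\mathcal{C}_s$) is $$g_s(x)=\prod_{i\in\Gamma_{(h)}\setminus\Gamma_{(h-1)}}m_{\alpha^{-(i+2^{h})}}(x)\prod_{j=1}^{h-2}\prod_{i\in\Gamma_{(j)}}m_{\alpha^{-(i+2^{j+1})}}(x),$$ the linear span of $s^\infty$ equals $m(2^{(m-2)/2}-1)$, and $\mathcal{C}_s$ has parameters $[2^m-1,\,2^m-1-m(2^{(m-2)/2}-1),\,d(\mathcal{C}_s)]$ with $2^{(m-4)/2}+1\le d(\mathcal{C}_s)\le 1+m(2^{(m-2)/2}-1)$.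
   Context: Let $v=2^m-1$, $\alpha$ a primitive element of $\mathbb{F}_{2^m}$, and $\operatorname{Tr}(x)=\sum_{i=0}^{m-1}x^{2^i}$ the absolute trace from $\mathbb{F}_{2^m}$ to $\mathbb{F}_2$. For a polynomial $F$ over $\mathbb{F}_{2^m}$ the binary sequence $s^\infty=(s_t)_{t\ge0}$ is defined by $s_t=\operatorname{Tr}(F(\alpha^t+1))$; it is periodic with period dividing $v$. Its minimal polynomial $g_s(x)$ is the polynomial $1+c_1x+\dots+c_Lx^L\in\mathbb{F}_2[x]$ of least degree $L$ such that $s_i+c_1s_{i-1}+\dots+c_Ls_{i-L}=0$ for all $i\ge L$; its degree $L_s$ is the linear span of $s^\infty$. $\mathcal{C}_s$ denotes the binary cyclic code of length $v$ with generator polynomial $g_s(x)$. For an integer $i$, $m_{\alpha^i}(x)$ is the minimal polynomial of $\alpha^i$ over $\mathbb{F}_2$. For a positive integer $t$, $\Gamma_{(t)}=\{j:1\le j\le 2^t-1,\ j\text{ odd}\}$. $d(\mathcal{C})$ denotes minimum Hamming distance. *)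

(* Defs.v *)
From HB Require Import structures.
From mathcomp Require Import all_boot all_order all_algebra.
Set Implicit Arguments. Unset Strict Implicit. Unset Printing Implicit Defensive.
Import GRing.Theory.
Local Open Scope ring_scope.

(* Embedding of the prime field F_2 into a ring F (meaningful in char 2). *)
Definition F2toF (F : nzRingType) (b : 'F_2) : F := (nat_of_ord b)%:R.

Definition trace (F : nzRingType) (m : nat) (x : F) : F :=
  \sum_(i < m) x ^+ (2 ^ i).

Definition f7 (F : nzRingType) (m : nat) (x : F) : F :=
  let h := (m %/ 2)%N in
  x + x ^+ (2 ^ h.+1 - 1) + x ^+ (2 ^ m - 2 ^ h.+1 + 2).

Definition seq_s (F : nzRingType) (m : nat) (alpha : F) (t : nat) : F :=
  trace m (f7 m (alpha ^+ t + 1)).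

Definition is_minpoly2 (F : fieldType) (beta : F) (p : {poly 'F_2}) : Prop :=
  [/\ p \is monic, root (map_poly (@F2toF F) p) beta &
      forall q : {poly 'F_2}, q != 0 -> root (map_poly (@F2toF F) q) beta ->
        (size p <= size q)%N].

Definition annihilates (F : nzRingType) (g : {poly 'F_2}) (s : nat -> F) : Prop :=
  forall i : nat, ((size g).-1 <= i)%N ->
    \sum_(k < size g) F2toF F g`_k * s (i - k)%N = 0.

Definition is_seq_minpoly (F : nzRingType) (s : nat -> F) (g : {poly 'F_2}) : Prop :=
  [/\ g`_0 = 1, annihilates g s &
      forall g' : {poly 'F_2}, g'`_0 = 1 -> annihilates g' s -> (size g <= size g')%N].

(* linear span = degree of the minimal polynomial *)
Definition linear_span (g : {poly 'F_2}) : nat := (size g).-1.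

Definition Gamma (t : nat) : seq nat := [seq j <- iota 1 (2 ^ t - 1) | odd j].

Definition cyclic_code (n : nat) (g : {poly 'F_2}) : {set 'rV['F_2]_n} :=
  [set c : 'rV['F_2]_n | g %| \sum_(i < n) (c 0 i)%:P * 'X^i].

Definition hweight (n : nat) (c : 'rV['F_2]_n) : nat := #|[set i | c 0 i != 0]|.

(* minimum Hamming distance of a linear code = minimum weight of a nonzero
   codeword (n.+1 if there is none) *)
Definition min_dist (n : nat) (C : {set 'rV['F_2]_n}) : nat :=
  \big[minn/n.+1]_(c in C | c != 0) hweight c.

(* Main.v *)
(* Expanding (x + 1)^(2^k - 1) as a geometric sum in characteristic 2, and using
   Tr(y^2) = Tr(y), all even exponents of Tr(f7(x + 1)) fold onto odd ones; what
   does not cancel is s_t = \sum_(e in exponents) Tr(alpha^(t e)).  The exponents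
   lie in distinct cyclotomic cosets of full size m, so s_t is the sum of the t-th
   powers of distinct z, and a Vandermonde argument identifies the annihilating
   polynomials of s with those vanishing at all the z^-1.  The lower bound on the
   distance is the BCH bound for the 2^(h-2) consecutive odd exponents just below
   2^(h+1); the generator polynomial itself is a codeword giving the upper bound. *)
Require Import Defs.
From HB Require Import structures.
From mathcomp Require Import all_boot all_order all_algebra.
From mathcomp Require Import finfield zify.
Import GRing.Theory.
Local Open Scope ring_scope.
Set Implicit Arguments. Unset Strict Implicit. Unset Printing Implicit Defensive.

(** * Power sums, cyclic codes and the prime field *)

(** Vandermonde in Lagrange form: by linearity [c] pairs to zero with every polynomial of size at
    most [#|A|], and the product of the ['X - (x k)%:P] over [A] without [i] isolates [c i]. *)
Lemma power_sums_eq0 (K : idomainType) (I : finType) (A : {pred I})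
    (x c : I -> K) :
    {in A &, injective x} ->
    (forall j, (j < #|A|)%N -> \sum_(i in A) c i * x i ^+ j = 0) ->
  {in A, forall i, c i = 0}.
Proof.
move=> xinj cx0 i iA.
have cp0 (p : {poly K}) : (size p <= #|A|)%N -> \sum_(k in A) c k * p.[x k] = 0.
  move=> szp; under eq_bigr do rewrite (horner_coef_wide _ szp) big_distrr.
  rewrite exchange_big big1 //= => j _.
  under eq_bigr do rewrite mulrCA.
  by rewrite -big_distrr /= cx0 ?mulr0 ?ltn_ord.
pose p := \prod_(k <- enum [predD1 A & i]) ('X - (x k)%:P).
have := cp0 p; rewrite size_prod_XsubC -cardE [X in (_ <= X)%N](cardD1 i) iA.
move=> /(_ (leqnn _)); rewrite (bigD1 i) //= [X in _ + X]big1 ?addr0; last first.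
  move=> k /andP[kA ki]; apply/eqP; rewrite mulf_eq0; apply/orP; right.
  rewrite horner_prod prodf_seq_eq0; apply/hasP; exists k.
    by rewrite mem_enum inE ki.
  by rewrite /= hornerXsubC subrr.
move/eqP; rewrite mulf_eq0 => /orP[/eqP //|].
rewrite horner_prod prodf_seq_eq0 => /hasP[k]; rewrite mem_enum inE => /andP[ki kA].
by rewrite /= hornerXsubC subr_eq0 => /eqP/xinj eik; rewrite eik ?eqxx // in ki.
Qed.

Lemma rVpolyE (R : nzRingType) n (c : 'rV[R]_n) :
  rVpoly c = \sum_(i < n) (c 0 i)%:P * 'X^i.
Proof.
rewrite /rVpoly poly_def; apply: eq_bigr => i _.
by rewrite valK mul_polyC.
Qed.

Lemma in_cyclic_code n (g : {poly 'F_2}) c :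
  (c \in cyclic_code n g) = (g %| rVpoly c).
Proof. by rewrite inE rVpolyE. Qed.

(** Multiplication by [g] maps the polynomials of size at most [n - L] bijectively onto the code. *)
Lemma card_cyclic_code n (g : {poly 'F_2}) :
  g != 0 -> ((size g).-1 <= n)%N ->
  #|cyclic_code n g| = (2 ^ (n - (size g).-1))%N.
Proof.
move=> g0; set L := (size g).-1 => Ln.
have szg : size g = L.+1 by rewrite polySpred.
have szM (u : 'rV['F_2]_(n - L)) : (size (rVpoly u * g)%R <= n)%N.
  apply: leq_trans (size_polyMleq _ _) _; rewrite szg addnS /=.
  by rewrite -[X in (_ <= X)%N](subnK Ln) leq_add2r size_poly.
pose f (u : 'rV['F_2]_(n - L)) : 'rV['F_2]_n := poly_rV (rVpoly u * g).
have fK u : rVpoly (f u) = rVpoly u * g by rewrite poly_rV_K.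
have finj : injective f.
  move=> u w /(congr1 rVpoly); rewrite !fK => /(mulIf g0).
  exact: (can_inj rVpolyK).
suff -> : cyclic_code n g = f @: setT.
  by rewrite card_imset // cardsT card_mx card_Fp // mul1n.
apply/setP=> c; rewrite in_cyclic_code; apply/idP/imsetP => [|[u _ ->]]; last first.
  by rewrite fK dvdp_mull.
move=> gc; exists (poly_rV (rVpoly c %/ g)) => //.
rewrite /f poly_rV_K; first by rewrite divpK // rVpolyK.
by rewrite size_divp // leq_sub2r ?size_poly.
Qed.

Lemma min_dist_le n (C : {set 'rV['F_2]_n}) c :
  c \in C -> c != 0 -> (min_dist C <= hweight c)%N.
Proof.
move=> cC c0; rewrite /min_dist unlock.
elim: (index_enum _) (mem_index_enum c) => //= a r IH.
rewrite inE => /predU1P[<-|/IH le_r]; first by rewrite cC c0 geq_minl.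
by case: ifP => // _; rewrite (leq_trans (geq_minr _ _)).
Qed.

(** The bound [d <= n.+1] covers the default value of the minimum. *)
Lemma min_dist_ge n (C : {set 'rV['F_2]_n}) d :
  (d <= n.+1)%N -> (forall c, c \in C -> c != 0 -> (d <= hweight c)%N) ->
  (d <= min_dist C)%N.
Proof.
move=> dn dC; rewrite /min_dist; elim/big_ind: _ => // [a b|c /andP[]].
  by rewrite leq_min => -> ->.
exact: dC.
Qed.

(** [g] is itself a codeword, supported on its first [size g] positions. *)
Lemma min_dist_cyclic_code_le n (g : {poly 'F_2}) :
  g != 0 -> (size g <= n)%N -> (min_dist (cyclic_code n g) <= size g)%N.
Proof.
move=> g0 gn; have gK := poly_rV_K gn.
apply: leq_trans (min_dist_le (c := poly_rV g) _ _) _.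
- by rewrite in_cyclic_code gK.
- by apply: contraNneq g0 => g0; rewrite -gK g0 linear0.
rewrite /hweight -[X in (_ <= X)%N]card_ord.
have winj : injective (widen_ord gn) by move=> i j [] /val_inj.
rewrite -(card_imset _ winj).
apply/subset_leq_card/subsetP => i; rewrite inE mxE => gi.
have ig : (i < size g)%N by rewrite ltnNge; apply: contra gi => gi; rewrite nth_default.
by apply/imsetP; exists (Ordinal ig) => //; apply: val_inj.
Qed.

(* [F2toF] carrying the proof that makes it a ring morphism. *)
Definition F2emb (F : nzRingType) (_ : 2%N \in [pchar F]) (b : 'F_2) : F :=
  F2toF F b.

Fact F2emb_zmod_morphism (F : nzRingType) (F2 : 2%N \in [pchar F]) :
  zmod_morphism (F2emb F2).
Proof.
have two0 : 1 + 1 = 0 :> F by have := pcharf0 F2.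
have N1 : - 1 = 1 :> F by apply/eqP; rewrite eq_sym -addr_eq0 two0.
case=> [[|[|a]] ia] [[|[|b]] ib] //=; rewrite /F2emb /F2toF /= ?subrr ?subr0 //.
by rewrite sub0r N1.
Qed.

Fact F2emb_monoid_morphism (F : nzRingType) (F2 : 2%N \in [pchar F]) :
  monoid_morphism (F2emb F2).
Proof.
split=> //.
case=> [[|[|a]] ia] [[|[|b]] ib] //=; rewrite /F2emb /F2toF /= ?mulr0 ?mul0r ?mulr1 //.
Qed.

HB.instance Definition _ (F : nzRingType) (F2 : 2%N \in [pchar F]) :=
  GRing.isZmodMorphism.Build _ _ (F2emb F2) (F2emb_zmod_morphism F2).
HB.instance Definition _ (F : nzRingType) (F2 : 2%N \in [pchar F]) :=
  GRing.isMonoidMorphism.Build _ _ (F2emb F2) (F2emb_monoid_morphism F2).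

Lemma expr2nD (R : comNzRingType) (x y : R) n : 2%N \in [pchar R] ->
  (x + y) ^+ (2 ^ n) = x ^+ (2 ^ n) + y ^+ (2 ^ n).
Proof.
move=> R2; apply: exprDn_pchar; rewrite (eq_pnat _ (pcharf_eq R2)) pnatX.
by rewrite pnat_id ?orbT.
Qed.

Lemma F2emb_exp2 (F : nzRingType) (F2 : 2%N \in [pchar F]) b n :
  F2emb F2 b ^+ (2 ^ n) = F2emb F2 b.
Proof.
rewrite -rmorphXn /=; congr (F2emb F2 _).
by elim: n => // n IH; rewrite expnS exprM; case: b IH => [[|[|a]] ia] //= IH;
 rewrite -[RHS]IH; congr (_ ^+ _); apply: val_inj.
Qed.

(** Frobenius is additive and fixes the coefficients, which come from the prime field. *)
Lemma root_map_F2_exp2 (F : finFieldType) (F2 : 2%N \in [pchar F])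
    (p : {poly 'F_2}) (b : F) n :
  root (map_poly (F2emb F2) p) b -> root (map_poly (F2emb F2) p) (b ^+ (2 ^ n)).
Proof.
rewrite /root !horner_coef => /eqP pb0; apply/eqP.
have : (\sum_(i < size (map_poly (F2emb F2) p))
  (map_poly (F2emb F2) p)`_i * b ^+ i) ^+ (2 ^ n) = 0.
  by rewrite pb0 expr0n expn_eq0.
rewrite (big_morph (fun x => x ^+ (2 ^ n)) (id1 := 0) (op1 := +%R)); last first.
- by rewrite expr0n expn_eq0.
- by move=> x y; apply: expr2nD.
move=> sum0; rewrite -[RHS]sum0; apply: eq_bigr => i _.
by rewrite exprMn coef_map F2emb_exp2 -!exprM mulnC.
Qed.

(* There are 2 ^ m.+1 polynomials of size at most m.+1 but only 2 ^ m values at b. *)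
Lemma F2_annihilator_exists (F : finFieldType) (F2 : 2%N \in [pchar F]) m (b : F) :
  #|F| = (2 ^ m)%N ->
  exists2 q : {poly 'F_2}, q != 0 & (size q <= m.+1)%N && root (map_poly (F2emb F2) q) b.
Proof.
move=> cF; pose f (u : 'rV['F_2]_m.+1) : F := (map_poly (F2emb F2) (rVpoly u)).[b].
have /injectivePn[u [w uw fuw]] : ~~ injectiveb f.
  apply/negP => /injectiveP/leq_card; rewrite cF card_mx card_Fp // mul1n.
  by rewrite leq_exp2l // ltnn.
exists (rVpoly (u - w)).
  apply: contraNneq uw => uw0; rewrite -subr_eq0.
  by rewrite -(rVpolyK (u - w)) uw0 linear0.
rewrite size_poly /root linearB rmorphB /= hornerD hornerN.
by move: fuw; rewrite /f => ->; rewrite subrr eqxx.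
Qed.

(** The [m] distinct conjugates of [b] are roots, so their product divides [p]; minimality against
    the annihilator found by counting bounds the degree of [p] by [m], and both sides are monic. *)
Lemma map_minpoly2_full_orbit (F : finFieldType) (F2 : 2%N \in [pchar F]) m
    (b : F) (p : {poly 'F_2}) :
  #|F| = (2 ^ m)%N -> uniq [seq b ^+ (2 ^ i) | i <- iota 0 m] ->
  is_minpoly2 b p ->
  map_poly (F2emb F2) p = \prod_(i <- iota 0 m) ('X - (b ^+ (2 ^ i))%:P).
Proof.
move=> cF ub [mon rt min].
have mmon : map_poly (F2emb F2) p \is monic by rewrite map_monic.
have szp : (size p <= m.+1)%N.
  have [q q0 /andP[szq rq]] := F2_annihilator_exists F2 b cF.
  by apply: leq_trans (min q q0 rq) szq.
pose P := \prod_(z <- [seq b ^+ (2 ^ i) | i <- iota 0 m]) ('X - z%:P).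
have dP : P %| map_poly (F2emb F2) p.
  apply: uniq_roots_dvdp; last by rewrite uniq_rootsE.
  apply/allP => _ /mapP[i _ ->]; exact: root_map_F2_exp2.
have Pmon : P \is monic by apply: monic_prod_XsubC.
have -> : \prod_(i <- iota 0 m) ('X - (b ^+ (2 ^ i))%:P) = P by rewrite /P big_map.
apply/esym/eqP; rewrite -eqp_monic // -dvdp_size_eqp // eqn_leq dvdp_leq ?monic_neq0 //=.
by rewrite size_map_poly size_prod_XsubC size_map size_iota.
Qed.

(** * Exponents and cyclotomic cosets *)

(* The exponents of the statement, for h = n.+1. *)
Definition exponents (n : nat) : seq nat :=
  [seq (i + 2 ^ n.+1)%N | i <- [seq i <- Gamma n.+1 | i \notin Gamma n]] ++
  flatten [seq [seq (i + 2 ^ j.+1)%N | i <- Gamma j] | j <- index_iota 1 n].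

Lemma mem_Gamma t i : (i \in Gamma t) = odd i && (i < 2 ^ t)%N.
Proof.
rewrite mem_filter mem_iota; case: (boolP (odd i)) => //= oi.
have := expn_gt0 2 t; case: i oi => //= i _; lia.
Qed.

Lemma Gamma_uniq t : uniq (Gamma t).
Proof. by rewrite filter_uniq ?iota_uniq. Qed.

Lemma GammaE t : Gamma t = [seq i <- index_iota 0 (2 ^ t) | odd i].
Proof.
by rewrite /Gamma /index_iota subn0; case: (2 ^ t)%N (expn_gt0 2 t) => // k _; rewrite subn1.
Qed.

Lemma GammaD t :
  [seq i <- Gamma t.+1 | i \notin Gamma t] =
  [seq i <- index_iota (2 ^ t) (2 ^ t.+1) | odd i].
Proof.
(* Both lists strictly increase, so equal membership suffices. *)
apply: (irr_sorted_eq ltn_trans ltnn).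
- by rewrite !(sorted_filter ltn_trans) ?iota_ltn_sorted.
- by rewrite (sorted_filter ltn_trans) ?iota_ltn_sorted.
move=> i; rewrite mem_filter !mem_Gamma mem_filter mem_index_iota.
by case: odd; rewrite //= -leqNgt.
Qed.

Lemma size_odd_filter a b :
  size [seq i <- index_iota a.*2 b.*2 | odd i] = (b - a)%N.
Proof.
elim: b => [|b IH]; first by rewrite /index_iota !sub0n.
have [ab|ba] := leqP a b; last by rewrite /index_iota (eqP (_ : b.+1.*2 - a.*2 == 0)%N) /=; lia.
rewrite /index_iota (_ : b.+1.*2 - a.*2 = b.*2 - a.*2 + 2)%N; last lia.
rewrite iotaD filter_cat size_cat IH /= subnKC ?leq_double //.
by rewrite odd_double /=; lia.
Qed.

Lemma size_Gamma t : size (Gamma t.+1) = (2 ^ t)%N.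
Proof. by rewrite GammaE expnS mul2n (size_odd_filter 0) subn0. Qed.

(** The top block has [2 ^ n] elements and block [j] has [2 ^ (j - 1)], for [j] from 1 to [n]. *)
Lemma size_exponents n : size (exponents n.+1) = (2 ^ n.+1 - 1)%N.
Proof.
rewrite size_cat size_map GammaD.
have -> : size [seq i <- index_iota (2 ^ n.+1) (2 ^ n.+2) | odd i] = (2 ^ n)%N.
  by rewrite !expnS !mul2n size_odd_filter; lia.
rewrite size_flatten /shape -map_comp sumnE big_map.
rewrite (_ : \sum_(j <- _) _ = 2 ^ n - 1)%N; first by rewrite expnS; have := expn_gt0 2 n; lia.
elim: n => [|n IH]; first by rewrite big_geq.
rewrite big_nat_recr //= IH size_map size_Gamma expnS.
have := expn_gt0 2 n; lia.
Qed.

(** The value [(2 ^ n.+1).+1] is the exceptional one in the coset argument. For [0 < n] it falls in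
    the gap between the lower blocks, all below [2 ^ n.+1], and the top block, which starts above
    [3 * 2 ^ n]. *)
Lemma mem_exponents n e : e \in exponents n ->
  [/\ odd e, (e < 2 ^ n.+2)%N & e != (2 ^ n.+1).+1 \/ n = 0%N].
Proof.
rewrite mem_cat => /orP[/mapP[i] | /flattenP[s /mapP[j jn ->]]].
  rewrite GammaD mem_filter mem_index_iota => /andP[oi /andP[i1 i2]] ->.
  split; first by rewrite oddD oi oddX.
  - by rewrite (expnS 2 n.+1); lia.
  case: n i1 {i2} => [|n]; first by right.
  by rewrite expnS; have := expn_gt0 2 n; left; lia.
move: jn; rewrite mem_index_iota => /andP[j1 jn] /mapP[i].
rewrite mem_Gamma => /andP[oi ij] ->.
have le_jn : (2 ^ j.+1 <= 2 ^ n)%N by rewrite leq_exp2l.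
by have := expn_gt0 2 j; split; [rewrite oddD oi oddX | | left]; rewrite ?expnS in le_jn *; lia.
Qed.

(** Block [j] lies between [2 ^ j.+1] and [3 * 2 ^ j], hence before block [j.+1] begins; the top
    block lies above them all. *)
Lemma exponents_uniq n : uniq (exponents n).
Proof.
rewrite cat_uniq; apply/and3P; split.
- rewrite map_inj_uniq; first by rewrite filter_uniq ?Gamma_uniq.
  by move=> ? ? /addIn.
- apply/hasPn => _ /flattenP[_ /mapP[j jn ->] /mapP[i ij ->]].
  apply/mapP => -[k]; rewrite GammaD mem_filter mem_index_iota.
  move=> /andP[_ /andP[k1 _]]; move: ij; rewrite mem_Gamma => /andP[_].
  move: jn; rewrite mem_index_iota => /andP[_ jn].
  have : (2 ^ j.+1 <= 2 ^ n)%N by rewrite leq_exp2l.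
  by rewrite !expnS; lia.
elim: n => [//|[//|n] IH].
have -> : index_iota 1 n.+2 = index_iota 1 n.+1 ++ [:: n.+1].
  by rewrite /index_iota !subSS !subn0 -{1}(addn1 n) (iotaD _ n 1) add1n.
rewrite map_cat flatten_cat cat_uniq {}IH /=.
rewrite cats0 map_inj_uniq ?Gamma_uniq ?andbT; last by move=> ? ? /addIn.
apply/hasPn => _ /mapP[k _ ->]; apply/flattenP => -[_ /mapP[j jn ->] /mapP[i ij e]].
move: jn ij; rewrite mem_index_iota mem_Gamma => /andP[_ jn] /andP[_ ij].
have : (2 ^ j.+1 <= 2 ^ n.+1)%N by rewrite leq_exp2l.
by move: e; rewrite !expnS; lia.
Qed.

(* For 0 < d < h the product e' * 2 ^ d is even and already reduced; d > h is
   symmetric; d = h swaps the two halves of the binary expansion, and only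
   2 ^ h + 1 is an odd number below 2 ^ h.+1 whose image is of the same kind. *)
Lemma cyclotomic_eq_shift h e e' d :
  (1 < h)%N -> odd e -> odd e' ->
  (e < 2 ^ h.+1)%N -> (e' < 2 ^ h.+1)%N -> e != (2 ^ h).+1 ->
  (d < h.*2)%N -> e = e' * 2 ^ d %[mod 2 ^ h.*2 - 1] -> d = 0%N /\ e = e'.
Proof.
move=> h1 oe oe' le le' ne dh ee'; set v := (2 ^ h.*2 - 1)%N in ee'.
have small k : (k < 2 ^ h.+1)%N -> odd k -> (k < v)%N.
  move=> kh _; rewrite /v; apply: leq_trans kh _.
  have : (2 ^ h.+2 <= 2 ^ h.*2)%N by rewrite leq_exp2l //; lia.
  by rewrite !expnS; have := expn_gt0 2 h; lia.
have low a b k : (a < 2 ^ h.+1)%N -> odd a -> (b < 2 ^ h.+1)%N -> odd b ->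
    (0 < k < h)%N -> a = b * 2 ^ k %[mod v] -> False.
  move=> la oa lb ob /andP[k0 kh].
  have ek : ~~ odd (b * 2 ^ k) by rewrite oddM oddX; case: (k) k0 => // ? _; rewrite andbF.
  rewrite modn_small ?small // modn_small; first by move=> ea; rewrite ea (negbTE ek) in oa.
  have bk : (b * 2 ^ k <= (2 ^ h.+1 - 1) * 2 ^ k)%N by rewrite leq_mul2r; lia.
  have : (2 ^ h.+1 * 2 ^ k <= 2 ^ h.*2)%N by rewrite -expnD leq_exp2l //; lia.
  move: bk; rewrite mulnBl mul1n /v.
  have : (1 < 2 ^ k)%N by rewrite -(expn0 2) ltn_exp2l.
  have := expn_gt0 2 h.*2.
  by lia.
have p2 : (2 ^ h.*2 = 1 %[mod v])%N.
  by rewrite -{1}(subnK (expn_gt0 2 h.*2 : (1 <= _)%N)) addnC modnDr.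
have [dlt|dgt|dE] := ltngtP d h.
- have [d0|d0] := posnP d; last by have := low e e' d le oe le' oe'; rewrite d0 dlt; move=> /(_ isT ee').
  move: ee'; rewrite d0 muln1 !modn_small ?small //.
- case: (low e' e (h.*2 - d)%N) => //; first lia.
  rewrite -modnMml ee' modnMml -mulnA -expnD subnKC 1?ltnW //.
  by rewrite -modnMmr p2 modnMmr muln1.
exfalso; move: ee'; rewrite {}dE => {dh d}.
set q := (2 ^ h)%N in ne *.
have q4 : (4 <= q)%N by rewrite -[4%N]/(2 ^ 2)%N leq_exp2l.
have vE : v = (q * q - 1)%N by rewrite /v -addnn expnD.
rewrite expnS -/q in le le'.
have [e'q|qe'] := ltnP e' q.
  (* Here [e' * q] is already reduced; being below [2 * q] it forces [e' = 1], so [e = q] would be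
     even. *)
  rewrite (modn_small (small e _ _)) ?expnS -/q // modn_small; last first.
    have : (e' * q <= q.-1 * q)%N by rewrite leq_mul2r; lia.
    by rewrite vE; nia.
  move=> ee'; have : (e' < 2)%N by nia.
  by case: e' oe' {le' e'q} ee' => [|[|]] //= _ ee'; move: oe; rewrite ee' mul1n /q oddX; lia.
(* As [q * q] is 1 modulo [v], the leading bit of [e'] returns as the unit bit. The bound [2 * q]
   then leaves [e' = q], which is even, or the excluded [e = q.+1]. *)
have -> : (e' * q = (e' - q) * q + 1 %[mod v])%N.
  have -> : (e' * q = (e' - q) * q + 1 + v)%N by rewrite vE mulnBl; nia.
  by rewrite modnDr.
rewrite (modn_small (small e _ _)) ?expnS -/q // modn_small; last first.
  have : ((e' - q) * q <= q.-1 * q)%N by rewrite leq_mul2r; lia.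
  by rewrite vE; nia.
move=> ee'; have : (e' - q < 2)%N by nia.
case e2 : (e' - q)%N ee' => [|[|]] // ee' _; last by rewrite ee' mul1n addn1 eqxx in ne.
have e'q : e' = q by lia.
by move: oe'; rewrite e'q /q oddX; lia.
Qed.

Lemma eqn_modMr k m n d :
  coprime d k -> (m * k == n * k %[mod d]) = (m == n %[mod d]).
Proof.
move=> cdk; wlog nm : m n / (n <= m)%N => [wl|].
  by have [/wl|/ltnW/wl //] := leqP n m; rewrite // eq_sym => ->; rewrite eq_sym.
by rewrite !eqn_mod_dvd ?leq_mul2r ?nm ?orbT // -mulnBl Gauss_dvdl.
Qed.

(** This says at once that the cosets are distinct and have full size [h.*2]. The modulus is odd, so
    [2 ^ a] cancels and a single shift by [b - a] remains. *)
Lemma exponents_cosets_inj n e e' a b (h := n.+3) :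
  e \in exponents n.+2 -> e' \in exponents n.+2 -> (a < h.*2)%N -> (b < h.*2)%N ->
  e * 2 ^ a = e' * 2 ^ b %[mod 2 ^ h.*2 - 1] -> e = e' /\ a = b.
Proof.
wlog ab : e e' a b / (a <= b)%N => [wl|] Ee Ee' am bm eq.
  have [/wl|/ltnW/wl] := leqP a b; first exact.
  by move=> /(_ e' e Ee' Ee bm am (esym eq))[-> ->].
have [oe le [ne|//]] := mem_exponents Ee; have [oe' le' _] := mem_exponents Ee'.
have co : coprime (2 ^ h.*2 - 1) (2 ^ a).
  by rewrite coprimeXr // coprimen2 oddB ?expn_gt0 // oddX.
have [||ba0 ->] := @cyclotomic_eq_shift h e e' (b - a) isT oe oe' le le' ne.
- by rewrite (leq_ltn_trans (leq_subr _ _)).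
- apply/eqP; rewrite -(eqn_modMr _ _ co) -mulnA -expnD subnK //; exact/eqP.
by lia.
Qed.

(** * Expansion of the trace *)

Lemma sum_even_odd (V : zmodType) (f : nat -> V) a b :
  \sum_(a.*2 <= i < b.*2) f i =
  \sum_(a <= i < b) f i.*2 + \sum_(a.*2 <= i < b.*2 | odd i) f i.
Proof.
have [ba|ab] := leqP b a; first by rewrite !big_geq ?leq_double ?addr0.
rewrite -(subnKC (ltnW ab)); elim: (b - a)%N => [|k IH].
  by rewrite addn0 !big_geq ?addr0.
rewrite addnS doubleS 2?big_nat_recr ?IH /=; [|lia..].
rewrite big_nat_recr /=; last lia.
rewrite [X in _ = _ + X](@big_cat_nat _ _ _ (a + k).*2) /=; [|lia..].
have -> : \sum_((a + k).*2 <= i < (a + k).*2.+2 | odd i) f i = f (a + k).*2.+1.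
  rewrite big_mkcond /= 2?big_nat_recr ?big_geq //=; [|lia..].
  by rewrite odd_double /= !add0r.
by rewrite [LHS](AC (2*1*1) ((1*3)*(2*4))).
Qed.

Lemma sum_odd_shift (V : zmodType) (f : nat -> V) a b c : ~~ odd c ->
  \sum_(a <= i < b | odd i) f (i + c)%N = \sum_(a + c <= i < b + c | odd i) f i.
Proof.
move=> /negbTE evc; rewrite big_addn addnK.
by apply: eq_bigl => i; rewrite oddD evc addbF.
Qed.

(** Meant for [f i] the trace of [x ^+ i]. Since [f i.*2 = f i], a sum over odd indices is a
    difference of sums over full intervals, and these differences telescope. *)
Lemma sum_exponents (V : zmodType) (f : nat -> V) n :
  (forall i, f i + f i = 0) -> (forall i, f i.*2 = f i) ->
  \sum_(e <- exponents n.+1) f e =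
  f 1%N + \sum_(i < 2 ^ n.+3) f i + \sum_(i < 2 ^ n.+1) f i
  + \sum_(i < 2 ^ n.+1) f (i + 2 ^ n.+2)%N.
Proof.
move=> ff f2.
have double0 (I : Type) (r : seq I) P (g : I -> nat) :
    \sum_(i <- r | P i) f (g i) + \sum_(i <- r | P i) f (g i) = 0.
  by rewrite -big_split big1 /=.
have halve a b : \sum_(a.*2 <= i < b.*2) f i =
    \sum_(a <= i < b) f i + \sum_(a.*2 <= i < b.*2 | odd i) f i.
  by rewrite sum_even_odd; under eq_bigr do rewrite f2.
(* [U k] runs over a dyadic interval and [B k] over the upper half of the next one; passing from [k]
   to [k.+1] adds exactly the odd indices of the new interval. *)
pose U k := \sum_(2 ^ k <= i < 2 ^ k.+1) f i.
pose B k := \sum_(3 * 2 ^ k <= i < 2 ^ k.+2) f i.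
have US k : U k.+1 = U k + \sum_(2 ^ k.+1 <= i < 2 ^ k.+2 | odd i) f i.
  by rewrite /U !(expnS 2 k.+1) [in LHS]expnS !mul2n halve expnS mul2n.
have BS k : B k.+1 = B k + \sum_(3 * 2 ^ k.+1 <= i < 2 ^ k.+3 | odd i) f i.
  by rewrite /B (expnS 2 k.+2) (expnS 2 k) !mul2n -doubleMr halve.
have GammaS j : \sum_(i <- Gamma j) f (i + 2 ^ j.+1)%N =
    \sum_(2 ^ j.+1 <= i < 3 * 2 ^ j | odd i) f i.
  rewrite GammaE big_filter sum_odd_shift ?oddX // add0n.
  by rewrite (_ : 3 * 2 ^ j = 2 ^ j + 2 ^ j.+1)%N // expnS; lia.
(* Up to signs, which vanish, block [j] is the change from [U j] to [U j.+1] plus that from [B j.-1]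
   to [B j]. The boundary [U 1 + B 0] is [f 2 + f 3 + f 3], that is [f 1]. *)
have G k : \sum_(1 <= j < k.+1) \sum_(i <- Gamma j) f (i + 2 ^ j.+1)%N =
    f 1%N + U k.+1 + B k.
  elim: k => [|k IH].
    rewrite big_geq // /U /B expn1 expn0 muln1 /= big_ltn // !big_nat1.
    by rewrite -(f2 1%N) addrA ff add0r ff.
  rewrite big_nat_recr //= IH GammaS (US k.+1) BS.
  rewrite (@big_cat_nat _ _ _ (3 * 2 ^ k.+1) (2 ^ k.+2) (2 ^ k.+3)) /=; [|rewrite !expnS; lia..].
  set X := \sum_(2 ^ k.+2 <= _ < _ | _) _; set Y := \sum_(3 * _ <= _ < _ | _) _.
  have YY : Y + Y = 0 by apply: double0.
  by rewrite [RHS](AC (1*(1*2)*2) ((1*2*5*3)*(4*6))) /= YY addr0.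
rewrite big_cat big_map big_flatten big_map /=.
under [X in _ + X]eq_bigr do rewrite big_map.
rewrite G GammaD big_filter.
have -> : \sum_(2 ^ n.+1 <= i < 2 ^ n.+2 | odd i) f (i + 2 ^ n.+2)%N =
   \sum_(3 * 2 ^ n.+1 <= i < 2 ^ n.+3 | odd i) f i.
  rewrite sum_odd_shift ?oddX // addnn -mul2n -expnS.
  by rewrite (_ : 3 * 2 ^ n.+1 = 2 ^ n.+1 + 2 ^ n.+2)%N // !expnS; lia.
rewrite addrC -addrA -BS -addrA -[RHS]addrA -[RHS]addrA; congr (_ + _).
rewrite -!(big_mkord xpredT) -!(big_mkord xpredT (fun i => f (i + _)%N)).
have -> : \sum_(0 <= i < 2 ^ n.+1) f (i + 2 ^ n.+2)%N =
    \sum_(2 ^ n.+2 <= i < 3 * 2 ^ n.+1) f i.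
  have -> := big_addn 0 (3 * 2 ^ n.+1) (2 ^ n.+2) xpredT f.
  by rewrite (_ : 3 * 2 ^ n.+1 - 2 ^ n.+2 = 2 ^ n.+1)%N // !expnS; lia.
have le12 : (2 ^ n.+1 <= 2 ^ n.+2)%N by rewrite leq_exp2l.
have le23 : (2 ^ n.+2 <= 3 * 2 ^ n.+1)%N by rewrite !expnS; lia.
have le34 : (3 * 2 ^ n.+1 <= 2 ^ n.+3)%N by rewrite !expnS; lia.
(* The long interval is cut at the ends of the two short ones, whose sums then occur twice and
   cancel, leaving [f 1 + U n.+1 + B n.+1]. *)
rewrite (@big_cat_nat _ _ _ (2 ^ n.+1) 0 (2 ^ n.+3)) //=; last lia.
rewrite (@big_cat_nat _ _ _ (2 ^ n.+2) (2 ^ n.+1) (2 ^ n.+3)) //=; last lia.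
rewrite (@big_cat_nat _ _ _ (3 * 2 ^ n.+1) (2 ^ n.+2) (2 ^ n.+3)) //=.
rewrite -/(U n.+1) -/(B n.+1).
set X := \sum_(0 <= _ < _) _; set Y := \sum_(2 ^ n.+2 <= _ < _) _.
have XX : X + X = 0 by apply: double0.
have YY : Y + Y = 0 by apply: double0.
by rewrite [RHS](AC (1*(1*2)*2) ((1*5)*(3*6)*(2*4))) /= XX YY !add0r.
Qed.

(** By induction: the upper half of the sum is the lower half times [x ^+ (2 ^ n)]. *)
Lemma expr_add1_geometric (R : comNzRingType) (x : R) n :
  2%N \in [pchar R] -> (x + 1) ^+ (2 ^ n - 1) = \sum_(i < 2 ^ n) x ^+ i.
Proof.
move=> R2; elim: n => [|n IH]; first by rewrite big_ord1 subnn.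
have -> : (2 ^ n.+1 - 1 = (2 ^ n - 1) + 2 ^ n)%N.
  by rewrite expnS; have := expn_gt0 2 n; lia.
rewrite exprD IH expr2nD // expr1n expnS mul2n -addnn big_split_ord /=.
rewrite mulrDr mulr1 addrC; congr (_ + _); rewrite mulr_suml.
by apply: eq_bigr => i _; rewrite exprD mulrC.
Qed.

Lemma traceD (R : comNzRingType) m (x y : R) :
  2%N \in [pchar R] -> trace m (x + y) = trace m x + trace m y.
Proof. by move=> R2; rewrite -big_split; apply: eq_bigr => i _; rewrite expr2nD. Qed.

Lemma trace0 (R : comNzRingType) m : trace m (0 : R) = 0.
Proof. by rewrite /trace big1 // => i _; rewrite expr0n expn_eq0. Qed.

Lemma trace_sum (R : comNzRingType) m I (r : seq I) (f : I -> R) :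
  2%N \in [pchar R] -> trace m (\sum_(i <- r) f i) = \sum_(i <- r) trace m (f i).
Proof.
move=> R2; apply: (big_morph (trace m)); last exact: trace0.
by move=> x y; apply: traceD.
Qed.

(** Squaring rotates the summands of the trace cyclically. *)
Lemma trace_sqr (R : comNzRingType) m (x : R) :
  x ^+ (2 ^ m) = x -> trace m (x ^+ 2) = trace m x.
Proof.
case: m => [|m] xm; first by rewrite /trace !big_ord0.
rewrite /trace big_ord_recr [RHS]big_ord_recl /= -exprM -expnS xm addrC expn0 expr1.
by congr (_ + _); apply: eq_bigr => i _; rewrite -exprM -expnS.
Qed.

Lemma trace_exp2 (R : comNzRingType) m (x : R) k :
  x ^+ (2 ^ m) = x -> trace m (x ^+ (2 ^ k)) = trace m x.
Proof.
move=> xm; elim: k => [|k IH]; first by rewrite expr1.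
by rewrite expnSr exprM trace_sqr // -exprM mulnC exprM xm.
Qed.

(** The three terms of [f7] match [f 1], the long sum, and the two short sums together in
    [sum_exponents]. *)
Lemma trace_f7 (R : comNzRingType) n (x : R) (h := n.+2) : 2%N \in [pchar R] ->
  x ^+ (2 ^ h.*2) = x ->
  trace h.*2 (f7 h.*2 (x + 1)) = \sum_(e <- exponents n.+1) trace h.*2 (x ^+ e).
Proof.
move=> R2 xm; set m := h.*2 in xm *.
have mh : (m %/ 2 = h)%N by rewrite /m -muln2 mulnK.
have xkm k : (x ^+ k) ^+ (2 ^ m) = x ^+ k by rewrite -exprM mulnC exprM xm.
have x1m : (x + 1) ^+ (2 ^ m) = x + 1 by rewrite expr2nD // xm expr1n.
have x1km k : ((x + 1) ^+ k) ^+ (2 ^ m) = (x + 1) ^+ k.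
  by rewrite -exprM mulnC exprM x1m.
pose T k := trace m (x ^+ k).
have T2 k i : T (i * 2 ^ k)%N = T i by rewrite /T exprM trace_exp2.
rewrite (@sum_exponents _ T); first last.
- by move=> i; rewrite -muln2 (T2 1%N).
- by move=> i; rewrite -mulr2n -mulr_natl pcharf0 // mul0r.
rewrite /f7 mh !traceD // -[RHS]addrA; congr (_ + _ + _).
(* The constant 1 has trace [m] times 1, which is zero because [m] is even. *)
- rewrite /T expr1 [trace m 1](_ : _ = 0) ?addr0 //.
  rewrite /trace; under eq_bigr do rewrite expr1n.
  by rewrite sumr_const card_ord /m -muln2 natrM (pcharf0 R2) mulr0.
- by rewrite expr_add1_geometric // trace_sum.
(* up to a squaring, the exponent is 1 + 2 ^ h + 2 ^ h.+1 + ... + 2 ^ (2 h - 2) *)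
have -> : (2 ^ m - 2 ^ h.+1 + 2 = (1 + 2 ^ h * (2 ^ n.+1 - 1)) * 2)%N.
  have -> : (2 ^ m = 2 ^ h * 2 ^ h)%N by rewrite /m -addnn expnD.
  rewrite mulnBr muln1 mulnDl mulnBl -mulnA -expnSr -(expnSr 2 h) mul1n addnC //.
rewrite exprM trace_sqr // exprD expr1 exprM expr2nD // expr1n.
rewrite expr_add1_geometric // mulrDl mul1r [RHS]addrC traceD // mulr_sumr !trace_sum //.
congr (_ + _); apply: eq_bigr => i _; last by rewrite -exprM mulnC -/(T _) T2.
(* The power [2 ^ h] turns the exponent [1 + 2 ^ h * i] into [2 ^ h + 2 ^ m * i], and
   [x ^+ (2 ^ m) = x] reduces this to [i + 2 ^ h]. *)
rewrite -exprM -exprS -/(T _) -(T2 h) mulSn mulnAC -expnD addnn -/m.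
by rewrite addnC /T exprD exprM xm -exprD.
Qed.

(** * Minimal polynomial of a power sum sequence; BCH bound *)

Lemma F2_eq1 (b : 'F_2) : b != 0 -> b = 1.
Proof. by case: b => [[|[|k]] ik] //= _; apply: val_inj. Qed.

(** At index [i] the recurrence is the sum over [z] of [z ^+ i] times the value of [g] at [z^-1];
    letting [i] grow from [(size g).-1], [power_sums_eq0] separates the terms. *)
Lemma annihilates_power_sums (F : finFieldType) (F2 : 2%N \in [pchar F])
    (zs : seq F) (s : nat -> F) (g : {poly 'F_2}) :
    uniq zs -> 0 \notin zs -> (forall t, s t = \sum_(z <- zs) z ^+ t) ->
  annihilates g s <-> {in zs, forall z, root (map_poly (F2emb F2) g) z^-1}.
Proof.
move=> uzs zs0 sE.
have annE i : ((size g).-1 <= i)%N ->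
    \sum_(k < size g) F2toF F g`_k * s (i - k)%N =
    \sum_(z in zs) z ^+ i * (map_poly (F2emb F2) g).[z^-1].
  move=> gi; under eq_bigr do rewrite sE big_uniq // mulr_sumr.
  rewrite exchange_big /=; apply: eq_bigr => z zzs.
  have z0 : z != 0 by apply: contraNneq zs0 => <-.
  rewrite (horner_coef_wide _ (leqnn _)) size_map_poly mulr_sumr.
  apply: eq_bigr => k _; rewrite coef_map /= mulrCA; congr (_ * _).
  rewrite exprVn exprB ?unitfE // (leq_trans _ gi) // -ltnS.
  exact: leq_trans (ltn_ord k) (leqSpred _).
split=> [ann|rt i gi]; last first.
  by rewrite annE // big1 // => z /rt/rootP ->; rewrite mulr0.
move=> z zzs; have z0 : z != 0 by apply: contraNneq zs0 => <-.
have c0 := @power_sums_eq0 F F (mem zs) id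
  (fun z => z ^+ (size g).-1 * (map_poly (F2emb F2) g).[z^-1]) (in2W (@inj_id F)).
have {c0}/c0/(_ z zzs)/eqP : forall j, (j < #|mem zs|)%N ->
    \sum_(y in zs) y ^+ (size g).-1 * (map_poly (F2emb F2) g).[y^-1] * y ^+ j = 0.
  move=> j _; rewrite -[RHS](ann ((size g).-1 + j)%N) ?leq_addr // annE ?leq_addr //.
  by apply: eq_bigr => y _; rewrite exprD mulrAC.
by rewrite mulf_eq0 expf_eq0 (negbTE z0) andbF.
Qed.

(** An annihilating polynomial vanishes at every [z^-1], so it has at least as many roots as the
    degree of [g]. *)
Lemma power_sums_minpoly (F : finFieldType) (F2 : 2%N \in [pchar F])
    (zs : seq F) (s : nat -> F) (g : {poly 'F_2}) :
    uniq zs -> 0 \notin zs -> (forall t, s t = \sum_(z <- zs) z ^+ t) ->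
    map_poly (F2emb F2) g = \prod_(z <- zs) ('X - (z^-1)%:P) ->
  is_seq_minpoly s g.
Proof.
move=> uzs zs0 sE gE.
have uzsV : uniq [seq z^-1 | z <- zs] by rewrite map_inj_uniq //; apply: invr_inj.
have rootE z : root (map_poly (F2emb F2) g) z = (z \in [seq z^-1 | z <- zs]).
  by rewrite -root_prod_XsubC big_map gE.
split.
- apply: F2_eq1; apply: contra zs0 => /eqP g00.
  have : root (map_poly (F2emb F2) g) 0.
    by rewrite /root horner_coef0 coef_map /= g00 rmorph0.
  by rewrite rootE => /mapP[z zzs /esym/eqP]; rewrite invr_eq0 => /eqP <-.
- apply/(annihilates_power_sums F2 _ uzs zs0 sE) => z zzs.
  by rewrite rootE map_f.
move=> g' g'0 /(annihilates_power_sums F2 _ uzs zs0 sE) rt.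
have g'n0 : g' != 0 by apply: contra_eq_neq g'0 => ->; rewrite coef0.
rewrite -(size_map_poly (F2emb F2) g) gE size_prod_XsubC -(size_map_poly (F2emb F2)).
rewrite -(size_map (@GRing.inv F)); apply: max_poly_roots => //.
  by rewrite map_poly_eq0.
by apply/allP => _ /mapP[z zzs ->]; apply: rt.
Qed.

(** In a word of weight at most [d], the zeros make the power sums of the nodes [a ^+ (k * i)] with
    weights [c 0 i * a ^+ (b * i)] vanish; [k] being coprime to [n], the nodes are distinct and the
    word is zero. *)
Lemma cyclic_code_BCH (F : finFieldType) (F2 : 2%N \in [pchar F]) n
    (g : {poly 'F_2}) (a : F) b k d :
    n.-primitive_root a -> coprime k n ->
    (forall j, (j < d)%N -> root (map_poly (F2emb F2) g) (a ^+ (b + k * j))) ->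
  (d <= n)%N -> (d < min_dist (cyclic_code n g))%N.
Proof.
move=> pa cokn gz dn; apply: min_dist_ge => // c; rewrite in_cyclic_code => gc.
apply: contraNltn => wc; apply/eqP/rowP => i; rewrite mxE.
apply/eqP; apply: contraT => ci.
have n0 := prim_order_gt0 pa.
have a0 : a != 0.
  by apply: contra_eq_neq (prim_expr_order pa) => ->; rewrite expr0n gtn_eqF // eq_sym oner_eq0.
pose A := [set i | c 0 i != 0].
have iA : i \in A by rewrite inE.
have ainj : {in A &, injective (fun i : 'I_n => (a ^+ k) ^+ i)}.
  have := exp_prim_root pa k; rewrite (eqP cokn) divn1 => pak.
  move=> i1 i2 _ _ /eqP; rewrite (eq_prim_root_expr pak) !modn_small //.
  by move=> /eqP/val_inj.
have := power_sums_eq0 (c := fun i => F2emb F2 (c 0 i) * a ^+ (b * i)) ainj.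
have cj j : (j < #|A|)%N ->
    \sum_(i in A) F2emb F2 (c 0 i) * a ^+ (b * i) * a ^+ k ^+ i ^+ j = 0.
  move=> jA; have /rootP := gz j (leq_trans jA wc).
  have /dvdpP[q qE] := gc.
  have : (map_poly (F2emb F2) (rVpoly c)).[a ^+ (b + k * j)] = 0.
    rewrite qE rmorphM hornerM /=.
    by rewrite (rootP (gz j (leq_trans jA wc))) mulr0.
  rewrite (@horner_coef_wide _ n) ?size_map_poly ?size_poly // => e0 _.
  rewrite -[RHS]e0 [RHS](bigID (mem A)) /= [X in _ + X]big1 ?addr0; last first.
    move=> l; rewrite inE negbK coef_map /= coef_rVpoly_ord => /eqP ->.
    by rewrite rmorph0 mul0r.
  apply: eq_bigr => l _; rewrite coef_map /= coef_rVpoly_ord -mulrA -!exprM -exprD.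
  by congr (_ * _ ^+ _); lia.
move=> /(_ cj i iA)/eqP; rewrite mulf_eq0 fmorph_eq0 (negbTE ci) /=.
by rewrite expf_eq0 (negbTE a0) andbF.
Qed.

(** * Generator polynomial, linear span and distance bounds for the trace sequence *)

Theorem theorem7 (m : nat) (hm6 : (6 <= m)%N) (hmeven : ~~ odd m)
    (F : finFieldType) (hF : #|F| = (2 ^ m)%N)
    (alpha : F) (halpha : (2 ^ m - 1).-primitive_root alpha)
    (mp : F -> {poly 'F_2}) (hmp : forall beta : F, is_minpoly2 beta (mp beta)) :
  let h := (m %/ 2)%N in
  let v := (2 ^ m - 1)%N in
  let s := seq_s m alpha in
  let gs := (\prod_(i <- [seq i <- Gamma h | i \notin Gamma h.-1])
                mp (alpha ^- (i + 2 ^ h)%N)) *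
            \prod_(1 <= j < h.-1) \prod_(i <- Gamma j) mp (alpha ^- (i + 2 ^ j.+1)%N) in
  let Cs := cyclic_code v gs in
  [/\ is_seq_minpoly s gs,
      linear_span gs = (m * (2 ^ ((m - 2) %/ 2) - 1))%N,
      #|Cs| = (2 ^ (v - m * (2 ^ ((m - 2) %/ 2) - 1)))%N &
      (2 ^ ((m - 4) %/ 2) + 1 <= min_dist Cs <= 1 + m * (2 ^ ((m - 2) %/ 2) - 1))%N].
Proof.
have [n mE] : exists n, m = n.+3.*2 by exists (m./2 - 3)%N; lia.
have F2 : 2%N \in [pchar F] by apply: card_finPcharP hF _.
move=> h v s gs Cs.
have hE : h = n.+3 by rewrite /h mE; lia.
have -> : ((m - 2) %/ 2 = n.+2)%N by lia.
have -> : ((m - 4) %/ 2 = n.+1)%N by lia.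
set L := (m * _)%N.
have alpha0 : alpha != 0.
  apply: contra_eq_neq (prim_expr_order halpha) => ->.
  by rewrite expr0n gtn_eqF ?(prim_order_gt0 halpha) // eq_sym oner_eq0.
(* All conjugates of the [alpha ^+ e]: expanding each trace makes [s t] the sum of their [t]-th
   powers. *)
pose zs := [seq (alpha ^+ e) ^+ (2 ^ i) | e <- exponents n.+2, i <- iota 0 m].
have zs_inj e e' a b : e \in exponents n.+2 -> e' \in exponents n.+2 ->
    (a < m)%N -> (b < m)%N ->
    (alpha ^+ e) ^+ (2 ^ a) = (alpha ^+ e') ^+ (2 ^ b) -> e = e' /\ a = b.
  move=> Ee Ee' am bm /eqP; rewrite -!exprM (eq_prim_root_expr halpha) => /eqP.
  by rewrite mE in am bm *; apply: exponents_cosets_inj.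
have uzs : uniq zs.
  apply: allpairs_uniq; rewrite ?exponents_uniq ?iota_uniq //.
  move=> _ _ /allpairsP[[e a] /= [Ee am ->]] /allpairsP[[e' b] /= [Ee' bm ->]] /= eq.
  rewrite !mem_iota in am bm.
  by have [-> ->] := zs_inj _ _ _ _ Ee Ee' am bm eq.
have zs0 : 0 \notin zs.
  apply/allpairsP => -[[e a] /= [_ _ /esym/eqP]].
  by rewrite -exprM expf_eq0 (negbTE alpha0) andbF.
have sE t : s t = \sum_(z <- zs) z ^+ t.
  rewrite /s /seq_s mE trace_f7 -?mE //; last by rewrite -hF expf_card.
  rewrite big_allpairs_dep; apply: eq_bigr => e _.
  rewrite /trace -(big_mkord xpredT (fun i => alpha ^+ t ^+ e ^+ (2 ^ i))) /index_iota subn0; apply: eq_bigr => i _.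
  by rewrite -!exprM; congr (_ ^+ _); lia.
have gsE : gs = \prod_(e <- exponents n.+2) mp (alpha ^- e).
  rewrite /gs hE big_cat big_map big_flatten big_map; congr (_ * _).
  by apply: eq_bigr => j _; rewrite big_map.
(* Each coset has full size [m], so every factor of [gs] splits over a whole orbit of inverses. *)
have mgsE : map_poly (F2emb F2) gs = \prod_(z <- zs) ('X - (z^-1)%:P).
  rewrite gsE rmorph_prod big_allpairs_dep; apply: eq_big_seq => e Ee /=.
  rewrite (map_minpoly2_full_orbit F2 hF _ (hmp _)).
    by apply: eq_bigr => i _; rewrite exprVn.
  rewrite map_inj_in_uniq ?iota_uniq // => a b; rewrite !mem_iota => am bm.
  by rewrite !exprVn => /invr_inj /(zs_inj _ _ _ _ Ee Ee am bm)[].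
have szgs : size gs = L.+1.
  rewrite -(size_map_poly (F2emb F2)) mgsE size_prod_XsubC size_allpairs.
  by rewrite size_exponents size_iota mulnC.
have gs0 : gs != 0 by rewrite -size_poly_gt0 szgs.
(* This lets the coefficients of [gs] fit into a word of length [v]; it rests on
   [n.+3 < 2 ^ n.+3]. *)
have Lv : (L.+1 <= v)%N.
  rewrite /L /v mE -addnn expnD mulnBr muln1.
  have : (n.+3 < 2 ^ n.+3)%N by apply: ltn_expl.
  by rewrite (expnS 2 n.+2); nia.
split.
- exact: power_sums_minpoly mgsE.
- by rewrite /linear_span szgs.
- by rewrite /Cs card_cyclic_code // szgs // ltnW.
rewrite addn1 add1n -szgs min_dist_cyclic_code_le ?szgs // andbT.
(* The zeros of [gs] are powers of [alpha^-1], so the BCH bound is applied to this root. *)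
have pV : v.-primitive_root alpha^-1.
  have -> : alpha^-1 = alpha ^+ v.-1.
    apply: (mulfI alpha0); rewrite divff // -exprS prednK ?prim_expr_order //.
    exact: prim_order_gt0 halpha.
  have := exp_prim_root halpha v.-1; rewrite (eqP (coprimePn _)) ?divn1 //.
  exact: prim_order_gt0 halpha.
(* With [h = n.+3], [b] is the least exponent of the top block and [k = 2] runs through its
   [2 ^ n.+1] consecutive odd numbers. *)
apply: (cyclic_code_BCH (F2 := F2) (b := (2 ^ n.+3 + 2 ^ n.+2 + 1)%N) (k := 2) pV).
- by rewrite coprime2n oddB ?expn_gt0 // oddX; lia.
- move=> j jn; rewrite mgsE -(big_map (@GRing.inv F) xpredT (fun z => 'X - z%:P)).
  rewrite root_prod_XsubC exprVn map_f //; apply/allpairsP.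
  exists ((2 ^ n.+3 + 2 ^ n.+2 + 1 + 2 * j)%N, 0%N) => /=; split.
  + rewrite mem_cat; apply/orP; left; apply/mapP.
    exists (2 ^ n.+2 + 1 + 2 * j)%N; last lia.
    by rewrite GammaD mem_filter mem_index_iota !expnS in jn *; lia.
  + by rewrite mem_iota; lia.
  by rewrite expn0 expr1.
apply: leq_trans Lv; rewrite /L mE !expnS; have := expn_gt0 2 n; nia.
Qed.
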